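(* Let $\mathcal{H}_A,\mathcal{H}_B$ be complex Hilbert spaces of finite dimensions $d_A,d_B$, and put $d=\min\{d_A,d_B\}$, $D=\max\{d_A,d_B\}$. Assume $D\le d^3$ and let $h$ be an integer with $1<h\le d^2$. Then for every separable state $\rho$ on $\mathcal{H}_A\otimes\mathcal{H}_B$ that is in Filter Normal Form, $$\mathcal{M}_{h,p=1}(\rho)\le S_h(\alpha,\beta,\ldots,\beta),$$ where $S_h$ is the $h$-th elementary symmetric polynomial in $d^2$ variables, the argument consists of $\alpha$ once and $\beta$ repeated $d^2-1$ times, and $$\alpha=\frac{1}{\sqrt{Dd}},\qquad \beta=\sqrt{\frac{D-1}{D(d^2-1)}\cdot\frac{d-1}{d(d^2-1)}}.$$
   Context: Let $\{A_i\}_{i=1}^{d_A^2}$ be an orthonormal basis of the real vector space of $d_A\times d_A$ Hermitian matrices with respect to the Hilbert–Schmidt inner product $\langle X,Y\rangle=\mathrm{tr}(XY)$, and $\{B_j\}_{j=1}^{d_B^2}$ likewise for $d_B\times d_B$ Hermitian matrices. For a state (density matrix) $\rho$ on $\mathcal{H}_A\otimes\mathcal{H}_B$, its correlation matrix is the real $d_A^2\times d_B^2$ matrix $\mathcal{C}_{ij}=\mathrm{tr}(\rho\, A_i\otimes B_j)$; let $\sigma_1\ge\cdots\ge\sigma_{d^2}\ge0$ be its singular values (these do not depend on the choice of the orthonormal bases). For $1\le h\le d^2$ and $p\in[1,\infty)$ the Correlation Minor Norm is $$\mathcal{M}_{h,p}(\rho)=\Big(\sum_{R\subseteq\{1,\ldots,d^2\},\,|R|=h}\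 \prod_{k\in R}\sigma_k^p\Big)^{1/p},$$ equivalently the Schatten $p$-norm of the $h$-th compound matrix of $\mathcal{C}$. In particular $\mathcal{M}_{h,1}=S_h(\sigma_1,\ldots,\sigma_{d^2})$, where $S_h(x_1,\ldots,x_n)=\sum_{|R|=h}\prod_{k\in R}x_k$. A state is separable if it is a convex combination of product states $\rho_A\otimes\rho_B$. A state $\rho$ is in Filter Normal Form (FNF) if $\mathrm{tr}(\rho\,(A\otimes\mathbb{1}))=0$ for every traceless Hermitian $A$ on $\mathcal{H}_A$ and $\mathrm{tr}(\rho\,(\mathbb{1}\otimes B))=0$ for every traceless Hermitian $B$ on $\mathcal{H}_B$. *)

(* Defs.v *)
From HB Require Import structures.
From mathcomp Require Import all_boot all_order all_algebra.
From mathcomp Require Import reals.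
From mathcomp Require Import complex mxtens.
From mathcomp Require Import sesquilinear spectral.

Set Implicit Arguments.
Unset Strict Implicit.
Unset Printing Implicit Defensive.

Import Order.TTheory GRing.Theory Num.Theory ComplexField.
Local Open Scope ring_scope.
Local Open Scope sesquilinear_scope.

(* Complex numbers over a real field R : realType are R[i]. *)
Section QInfo.
Variable R : realType.
Local Notation C := R[i].

(* Hermitian matrices: M equals its conjugate transpose. *)
Definition hermmx n (M : 'M[C]_n) : bool := M ^t* == M.

(* Positive semidefinite: Hermitian with nonnegative quadratic form. *)
Definition psdmx n (M : 'M[C]_n) : Prop :=
  hermmx M /\ forall v : 'rV[C]_n, 0 <= (v *m M *m v ^t*) 0 0.

(* Density matrix (state). *)
Definition is_state n (rho : 'M[C]_n) : Prop := psdmx rho /\ \tr rho = 1.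

(* Orthonormal basis (w.r.t. Hilbert-Schmidt inner product tr(XY)) of the
   real vector space of n x n Hermitian matrices (of dimension n^2). *)
Definition herm_onb n (A : 'I_(n ^ 2) -> 'M[C]_n) : Prop :=
  (forall i, hermmx (A i)) /\
  (forall i j, \tr (A i *m A j) = (i == j)%:R).

(* Separable state on H_A (x) H_B: finite convex combination of product
   states rho_A (x) rho_B (Kronecker product). *)
Definition separable dA dB (rho : 'M[C]_(dA * dB)) : Prop :=
  exists (K : nat) (p : 'I_K -> R) (rA : 'I_K -> 'M[C]_dA)
         (rB : 'I_K -> 'M[C]_dB),
    [/\ forall k, 0 <= p k,
        \sum_(k < K) p k = 1,
        forall k, is_state (rA k) /\ is_state (rB k) &
        rho = \sum_(k < K) real_complex R (p k) *: (rA k *t rB k)].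

(* Filter normal form: vanishing local expectations of traceless observables. *)
Definition filter_normal_form dA dB (rho : 'M[C]_(dA * dB)) : Prop :=
  (forall A : 'M[C]_dA, hermmx A -> \tr A = 0 ->
      \tr (rho *m (A *t (1%:M : 'M[C]_dB))) = 0) /\
  (forall B : 'M[C]_dB, hermmx B -> \tr B = 0 ->
      \tr (rho *m ((1%:M : 'M[C]_dA) *t B)) = 0).

(* Correlation matrix C_ij = tr(rho (A_i (x) B_j)). *)
Definition corr_mx dA dB (rho : 'M[C]_(dA * dB))
  (A : 'I_(dA ^ 2) -> 'M[C]_dA) (B : 'I_(dB ^ 2) -> 'M[C]_dB)
  : 'M[C]_(dA ^ 2, dB ^ 2) :=
  \matrix_(i, j) \tr (rho *m (A i *t B j)).

(* Rectangular "diagonal" matrix with diagonal entries s 0, s 1, ... *)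
Definition rdiag_mx m n (s : nat -> R) : 'M[C]_(m, n) :=
  \matrix_(i, j) (if (i : nat) == (j : nat) then real_complex R (s i) else 0).

(* s 0, ..., s (minn m n - 1) are the singular values of M:
   M = U Sigma V^* with U, V unitary and Sigma rectangular diagonal with
   nonnegative diagonal entries s k. *)
Definition singular_values m n (M : 'M[C]_(m, n)) (s : nat -> R) : Prop :=
  (forall k, (k < minn m n)%N -> 0 <= s k) /\
  exists (U : 'M[C]_m) (V : 'M[C]_n),
    [/\ U \is unitarymx, V \is unitarymx & M = U *m rdiag_mx m n s *m V ^t*].

End QInfo.

(* h-th elementary symmetric polynomial S_h in n variables. *)
Definition esym_poly (R : numDomainType) n h (x : 'I_n -> R) : R :=
  \sum_(S : {set 'I_n} | #|S| == h) \prod_(k in S) x k.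

(* Correlation minor norm M_{h,1} = S_h(sigma_1, ..., sigma_{d^2}). *)
Definition CMN1 (R : realType) m n h (s : nat -> R) : R :=
  esym_poly h (fun k : 'I_(minn m n) => s (k : nat)).

(* Main.v *)
Require Import Defs.
From HB Require Import structures.
From mathcomp Require Import all_boot all_order all_algebra.
From mathcomp Require Import reals.
From mathcomp Require Import complex mxtens.
From mathcomp Require Import sesquilinear spectral.
From mathcomp Require Import ring lra.
Import Order.TTheory GRing.Theory Num.Theory ComplexField.
Local Open Scope ring_scope.
Local Open Scope sesquilinear_scope.

(* Let C be the correlation matrix and a, b the coordinate vectors of the two
   identity matrices.  Filter normal form says C b = a / dA and C^* a = b / dB, so alpha = 1 / sqrt(dA dB)
   is one of the singular values, and C = a b^T / (dA dB) + sum_k p_k xi_k eta_k^T,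
   where xi_k, eta_k are the coordinates of rho_A,k - 1/dA and rho_B,k - 1/dB.
   These have squared length tr(rho^2) - 1/n <= 1 - 1/n, so the trace norm of C
   is at most alpha + sqrt((1 - 1/dA) (1 - 1/dB)) = alpha + (d^2 - 1) beta.
   Hence the d^2 - 1 remaining singular values have mean at most beta, and
   Maclaurin's inequality bounds their elementary symmetric polynomials. *)

(** * Elementary symmetric polynomials and Maclaurin's inequality *)

(** As coefficients of a product, the symmetric sums can be handled one variable at a time: each
    variable is one linear factor. *)
Lemma esym_polyE (R : numDomainType) n h (x : 'I_n -> R) :
  esym_poly h x = (\prod_(i < n) (1 + x i *: 'X))`_h.
Proof.
have -> : \prod_(i < n) (1 + x i *: 'X) = \prod_(i < n) (x i *: 'X + 1).
  by apply: eq_bigr => i _; rewrite addrC.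
rewrite bigA_distr coef_sum /esym_poly [LHS]big_mkcond /=.
apply: eq_bigr => S _.
rewrite -big_mkcond /= scaler_prod prodr_const coefZ coefXn eq_sym.
by case: eqP => _; rewrite ?mulr1 ?mulr0.
Qed.

(** Convexity of [t ^ h.+1], a homogeneous Bernoulli inequality. Multiplying the induction
    hypothesis by [m + e] leaves the surplus [h.+1 * m ^ h * e ^ 2]. *)
Lemma tangent_le_expr (R : realFieldType) (m e : R) h :
  0 <= m -> 0 <= m + e -> m ^+ h.+1 + h.+1%:R * m ^+ h * e <= (m + e) ^+ h.+1.
Proof.
move=> m0 me0; elim: h => [|h IH]; first by rewrite expr0 !expr1 mulr1 mul1r.
rewrite [(m + e) ^+ h.+2]exprS; apply: le_trans (ler_wpM2l me0 IH).
have mh : 0 <= m ^+ h by apply: exprn_ge0.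
rewrite -subr_ge0 [X in 0 <= X](_ : _ = h.+1%:R * m ^+ h * e ^+ 2).
  by rewrite mulr_ge0 ?sqr_ge0 // mulr_ge0.
by rewrite !exprS -[h.+2%:R]natr1; ring.
Qed.

Lemma coef_mul1DX (R : comNzRingType) (x : R) (p : {poly R}) h :
  ((1 + x *: 'X) * p)`_h = p`_h + (if h is k.+1 then x * p`_k else 0).
Proof.
rewrite mulrDl mul1r coefD -scalerAl coefZ coefXM.
by case: h => [|h] /=; rewrite ?mulr0.
Qed.

(* Maclaurin's inequality [e_h <= C(n, h) m ^ h].  Adding a variable [x] moves
   the mean from [m] to [m + (x - m) / (n + 1)], and the bound for [n]
   variables is then exactly the tangent to [t ^ h] at [t = m]. *)
Lemma coef_prod1DX_le_mean (R : realFieldType) (s : seq R) (m : R) h :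
  all (fun x => 0 <= x) s -> 0 <= m -> \sum_(x <- s) x = (size s)%:R * m ->
  (\prod_(x <- s) (1 + x *: 'X))`_h <= 'C(size s, h)%:R * m ^+ h.
Proof.
elim: s m h => [|x s IH] m h /=.
  move=> _ m0 _; rewrite big_nil coef1 bin0n.
  by case: h => [|h] /=; rewrite ?expr0 ?mul1r ?mul0r.
case/andP=> x0 s0 m0; rewrite !big_cons => sumE.
set S := \sum_(y <- s) y in sumE.
have S0 : 0 <= S by rewrite /S big_seq sumr_ge0 // => y /(allP s0).
(* The mean [m'] of the tail makes sense only when the tail is nonempty. *)
have [s_nil|s_pos] := posnP (size s).
  move: sumE; rewrite /S (size0nil s_nil) /= !big_nil addr0 mulr1 mul1r => <-.
  rewrite coefD coef1 coefZ coefX.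
  case: h => [|[|h]] /=; rewrite ?expr0 ?expr1 ?mulr0 ?mulr1 ?mul1r;
    by rewrite ?add0r ?addr0 ?bin1 ?bin0 ?mul0r.
set n := size s in s_pos IH sumE *.
have n0 : (0 : R) < n%:R by rewrite ltr0n.
pose m' := S / n%:R.
have m'0 : 0 <= m' by rewrite divr_ge0 // ltW.
have SE : S = n%:R * m' by rewrite /m' mulrC divfK // gt_eqF.
clearbody m'; rewrite coef_mul1DX.
case: h => [|h].
  by have := IH m' 0%N s0 m'0 SE; rewrite !bin0 !expr0 addr0.
have n1 : (0 : R) < n.+1%:R by rewrite ltr0n.
have mE : m = m' + (x - m') / n.+1%:R.
  apply: (mulfI (lt0r_neq0 n1)); rewrite -sumE SE mulrDr [_ * (_ / _)]mulrC divfK ?gt_eqF //.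
  by rewrite -natr1; ring.
apply: le_trans (lerD (IH m' h.+1 s0 m'0 SE) (ler_wpM2l x0 (IH m' h s0 m'0 SE))) _.
have := @tangent_le_expr R m' ((x - m') / n.+1%:R) h m'0; rewrite -mE => /(_ m0).
move=> /(ler_wpM2l (ler0n R 'C(n.+1, h.+1))); apply: le_trans.
(* This absorption identity turns the slope term of the tangent, weighted by ['C(n.+1, h.+1)], into
   ['C(n, h) * m' ^ h * (x - m')]. Pascal's rule then makes both sides equal. *)
have binE : (h.+1%:R * 'C(n.+1, h.+1)%:R : R) = n.+1%:R * 'C(n, h)%:R.
  by rewrite -!natrM mul_bin_diag.
rewrite mulrDr.
have -> : 'C(n.+1, h.+1)%:R * (h.+1%:R * m' ^+ h * ((x - m') / n.+1%:R))
   = (n.+1%:R * 'C(n, h)%:R) * m' ^+ h * ((x - m') / n.+1%:R).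
  by rewrite -binE; ring.
have -> : n.+1%:R * 'C(n, h)%:R * m' ^+ h * ((x - m') / n.+1%:R)
   = 'C(n, h)%:R * m' ^+ h * (x - m').
  by move: (lt0r_neq0 n1); move: (n.+1%:R) => N N0; field.
by rewrite binS natrD exprS; lra.
Qed.

(** Both sides share the factor [1 + a *: 'X], so it is enough to compare the other [n.-1]
    variables, whose mean on the left is at most [b]. The sizes [n] and [n'] are separate because in
    the application they are equal without being convertible. *)
Lemma esym_poly_le_equalized (R : realFieldType) n n' h (x : 'I_n -> R) (j : 'I_n)
    (z : 'I_n' -> R) (j' : 'I_n') (a b : R) :
  n = n' -> (0 < n.-1)%N ->
  (forall i, 0 <= x i) -> 0 <= b -> x j = a ->
  \sum_i x i <= a + n.-1%:R * b ->
  z j' = a -> (forall i, i != j' -> z i = b) ->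
  esym_poly h x <= esym_poly h z.
Proof.
move=> nn' n1 x0 b0 xj sumx zj zb.
have a0 : 0 <= a by rewrite -xj.
rewrite !esym_polyE (bigD1 j) //= (bigD1 (P := predT) j') //= xj zj.
have -> : \prod_(i < n' | i != j') (1 + z i *: 'X) = (1 + b *: 'X) ^+ n.-1.
  rewrite (eq_bigr (fun => 1 + b *: 'X)) => [|i /zb -> //].
  by rewrite prodr_const cardC1 card_ord nn'.
set s := [seq x i | i <- index_enum 'I_n & i != j].
have -> : \prod_(i < n | i != j) (1 + x i *: 'X) = \prod_(t <- s) (1 + t *: 'X).
  by rewrite big_map big_filter.
have sz : size s = n.-1.
  by rewrite size_map -[size _]sum1_size big_filter sum1_card cardC1 card_ord.
pose m := (\sum_(t <- s) t) / n.-1%:R.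
have n10 : (0 : R) < n.-1%:R by rewrite ltr0n.
have s0 : all (fun t => 0 <= t) s by apply/allP => t /mapP [i _ ->].
have m0 : 0 <= m.
  by apply: divr_ge0 (ltW n10); rewrite big_seq sumr_ge0 // => t /(allP s0).
have mb : m <= b.
  rewrite ler_pdivrMr // mulrC big_map big_filter.
  by move: sumx; rewrite (bigD1 j) //= xj lerD2l.
(* All degrees are needed: multiplying by [1 + a *: 'X] mixes the coefficients of degrees [h] and
   [h - 1]. *)
have le k : (\prod_(t <- s) (1 + t *: 'X))`_k <= ((1 + b *: 'X) ^+ n.-1)`_k.
  have -> : ((1 + b *: 'X) ^+ n.-1)`_k = 'C(n.-1, k)%:R * b ^+ k.
    rewrite exprDn coef_sum.
    have [kn|nk] := leqP k n.-1; last first.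
      rewrite bin_small // mul0r big1 // => i _.
      rewrite expr1n mul1r exprZn coefMn coefZ coefXn.
      by rewrite gtn_eqF ?mulr0 ?mul0rn // (leq_ltn_trans _ nk) // -ltnS.
    rewrite (bigD1 (Ordinal (n := n.-1.+1) kn)) //= expr1n mul1r exprZn coefMn coefZ coefXn.
    rewrite eqxx mulr1 mulr_natl big1 ?addr0 // => i ik.
    rewrite expr1n mul1r exprZn coefMn coefZ coefXn eq_sym.
    by rewrite (negPf (_ : nat_of_ord i != k)) ?mulr0 ?mul0rn.
  apply: le_trans (coef_prod1DX_le_mean R s m k s0 m0 _) _.
    by rewrite sz mulrC divfK // gt_eqF.
  by rewrite sz; apply: ler_wpM2l => //; apply: lerXn2r.
rewrite !coef_mul1DX; apply: lerD; first exact: le.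
by case: h => // h; apply: ler_wpM2l.
Qed.

(** * Hermitian orthonormal bases and purity of states *)

Lemma mxvec_dot_tr (F : comNzRingType) n (X Y : 'M[F]_n) :
  \sum_k mxvec X 0 k * mxvec Y^T 0 k = \tr (X *m Y).
Proof.
rewrite (reindex _ (curry_mxvec_bij n n)) /=.
transitivity (\sum_i \sum_j X i j * Y j i).
  by rewrite pair_bigA; apply: eq_bigr => -[i j] _; rewrite /= !mxvecE mxE.
by rewrite /mxtrace; apply: eq_bigr => i _; rewrite mxE.
Qed.

(** Thanks to the transpose in [H], orthonormality reads [G *m H^T = 1]. The matrices are square, so
    also [H^T *m G = 1], which is completeness of the family. *)
Lemma onb_expansion (F : comUnitRingType) n (A : 'I_(n ^ 2) -> 'M[F]_n) :
  (forall i j, \tr (A i *m A j) = (i == j)%:R) ->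
  forall X, X = \sum_i \tr (X *m A i) *: A i.
Proof.
move=> orthA X.
pose G : 'M[F]_(n * n) := \matrix_(i < n * n) mxvec (A i).
pose H : 'M[F]_(n * n) := \matrix_(i < n * n) mxvec (A i)^T.
have GH : G *m H^T = 1%:M.
  apply/matrixP => i j; rewrite !mxE -orthA -mxvec_dot_tr.
  by apply: eq_bigr => k _; rewrite !mxE.
have HG := mulmx1C GH.
apply: (can_inj mxvecK); rewrite -[LHS]mulmx1 -HG mulmxA.
rewrite mulmx_sum_row linear_sum; apply: eq_bigr => i _.
rewrite linearZ rowK; congr (_ *: _); rewrite mxE -mxvec_dot_tr.
by apply: eq_bigr => k _; rewrite !mxE.
Qed.

Lemma onb_parseval (F : comUnitRingType) n (A : 'I_(n ^ 2) -> 'M[F]_n) :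
  (forall i j, \tr (A i *m A j) = (i == j)%:R) ->
  forall X Y, \sum_i \tr (X *m A i) * \tr (Y *m A i) = \tr (X *m Y).
Proof.
move=> orthA X Y.
rewrite {2}(onb_expansion _ _ _ orthA X) mulmx_suml linear_sum /=.
by apply: eq_bigr => i _; rewrite -scalemxAl linearZ /= (mxtrace_mulC Y).
Qed.

Lemma mxtrace_tens (F : comNzRingType) m n (X : 'M[F]_m) (Y : 'M[F]_n) :
  \tr (X *t Y) = \tr X * \tr Y.
Proof. by rewrite /mxtrace mulr_sum; apply: eq_bigr => k _; rewrite mxE. Qed.

Lemma mxtraceC (C : numClosedFieldType) n (X : 'M[C]_n) : \tr (X ^t*) = (\tr X)^*.
Proof. by rewrite trace_map_mx mxtrace_tr. Qed.

Lemma hermmx_trM_real (R : realType) n (X Y : 'M[R[i]]_n) :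
  hermmx X -> hermmx Y -> \tr (X *m Y) \is Num.real.
Proof.
move=> /eqP hX /eqP hY; apply/CrealP.
by rewrite -mxtraceC trmx_mul map_mxM hX hY mxtrace_mulC.
Qed.

Lemma hermmx_tr_real (R : realType) n (X : 'M[R[i]]_n) : hermmx X -> \tr X \is Num.real.
Proof. by move=> /eqP hX; apply/CrealP; rewrite -mxtraceC hX. Qed.

Lemma hermmx_subl_scalar (R : realType) n (X : 'M[R[i]]_n) (c : R[i]) :
  hermmx X -> c \is Num.real -> hermmx (X - c%:M).
Proof.
move=> /eqP hX /CrealP hc; apply/eqP.
by apply/matrixP => i j; rewrite -[in RHS]hX !mxE rmorphB rmorphMn /= hc eq_sym.
Qed.

(** The eigenvalues are nonnegative with sum 1, hence each is at most 1, and the sum of their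
    squares is at most their sum. *)
Lemma state_purity (R : realType) n (r : 'M[R[i]]_n) : is_state r -> \tr (r *m r) <= 1.
Proof.
move=> [[hr pr] tr1].
have /hermitian_normalmx /orthomx_spectralP rE : r \is hermsymmx.
  by apply/is_hermitianmxP; rewrite expr0 scale1r (eqP hr).
set P := spectralmx r in rE; set D := spectral_diag r in rE.
have uP : P \is unitarymx by apply: spectral_unitarymx.
have PV : invmx P = P ^t* by apply: invmx_unitary.
have PP : P *m invmx P = 1%:M by rewrite mulmxV // unitarymx_unit.
have D0 i : 0 <= D 0 i.
  (* Row [i] of [P] is a unit eigenvector, so the quadratic form there equals the eigenvalue. *)
  have := pr (row i P); rewrite {1}rE !mulmxA -row_mul PP.
  rewrite row1 -[_ *m P *m _]mulmxA.
  have -> : P *m (row i P) ^t* = (delta_mx 0 i)^T.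
    apply/colP => k; have /matrixP/(_ k i) := PP; rewrite PV !mxE => <-.
    by apply: eq_bigr => l _; rewrite !mxE.
  by rewrite -rowE row_diag_mx -scalemxAl mxE trmx_delta mul_delta_mx mxE !eqxx mulr1.
have trD : \sum_i D 0 i = 1.
  by rewrite -tr1 rE mxtrace_mulC mulmxA PP mul1mx mxtrace_diag.
have -> : \tr (r *m r) = \sum_i D 0 i * D 0 i.
  rewrite rE -!mulmxA mxtrace_mulC !mulmxA.
  rewrite -[_ *m P *m invmx P]mulmxA PP mulmx1 -[_ *m P *m invmx P]mulmxA PP mulmx1.
  rewrite mulmx_diag mxtrace_diag; by apply: eq_bigr => i _; rewrite mxE.
rewrite -[1]mulr1 -{1}trD mulr_suml; apply: ler_sum => i _.
apply: ler_wpM2l => //; rewrite -trD (bigD1 i) //= lerDl.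
exact: sumr_ge0.
Qed.

(** By Parseval the sum is [\tr (X *m X)] for the centred state [X], which expands to the purity of
    [r] minus [1 / n]. *)
Lemma state_centered_norm (R : realType) n (A : 'I_(n ^ 2) -> 'M[R[i]]_n) (r : 'M[R[i]]_n) :
  (0 < n)%N -> herm_onb A -> is_state r ->
  \sum_i `|\tr (r *m A i) - \tr (A i) / n%:R| ^+ 2 <= 1 - n%:R^-1.
Proof.
move=> n0 [hA oA] sr; have [[hr pr] tr1] := sr.
have nR : (n%:R : R[i]) != 0 by rewrite pnatr_eq0 -lt0n.
pose X := r - (n%:R^-1)%:M.
have hX : hermmx X by apply: hermmx_subl_scalar; rewrite // realV realn.
rewrite (eq_bigr (fun i => \tr (X *m A i) * \tr (X *m A i))); last first.
  move=> i _; rewrite /X -expr2 real_normK.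
    by rewrite mulmxBl raddfB /= mul_scalar_mx mxtraceZ mulrC.
  by rewrite rpredB ?hermmx_trM_real // rpredM ?hermmx_tr_real // realV realn.
rewrite onb_parseval // /X mulmxBl !mulmxBr !mul_scalar_mx !mul_mx_scalar.
rewrite !raddfB /= !mxtraceZ tr1 mxtrace_scalar mulr1 -[_^-1 *+ n]mulr_natr mulVf // mulr1 subrr addr0.
by rewrite lerD2r state_purity.
Qed.

(** * Singular values and the trace norm *)

(** A trace for rectangular matrices. After rotation by the unitaries of a singular value
    decomposition it is the sum of the singular values. *)
Definition diag_sum {F : nmodType} {m n} (M : 'M[F]_(m, n)) : F :=
  \sum_(k < minn m n) M (widen_ord (geq_minl m n) k) (widen_ord (geq_minr m n) k).

Lemma unitary_norm (C : numClosedFieldType) n (U : 'M[C]_n) (x : 'rV[C]_n) :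
  U \is unitarymx -> \sum_i `|(x *m U) 0 i| ^+ 2 = \sum_i `|x 0 i| ^+ 2.
Proof.
have normE (v : 'rV[C]_n) : \sum_i `|v 0 i| ^+ 2 = (v *m v ^t*) 0 0.
  by rewrite mxE; apply: eq_bigr => i _; rewrite normCK !mxE.
move=> /unitarymxP uU; rewrite !normE trmx_mul map_mxM.
by rewrite mulmxA -[x *m U *m _]mulmxA uU mulmx1.
Qed.

(** The difference is [(e * a - c * b) ^ 2 / (2 * c * e)]. The weights make the right-hand side
    equal to [c * e] when [a ^ 2] and [b ^ 2] are replaced by [c ^ 2] and [e ^ 2], so summing it
    termwise does the work of Cauchy-Schwarz. *)
Lemma weighted_amgm (C : numFieldType) (c e a b : C) :
  0 < c -> 0 < e -> a \is Num.real -> b \is Num.real ->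
  a * b <= 2^-1 * (e / c * a ^+ 2 + c / e * b ^+ 2).
Proof.
move=> c0 e0 ra rb; rewrite -subr_ge0.
have -> : 2^-1 * (e / c * a ^+ 2 + c / e * b ^+ 2) - a * b =
    2^-1 * (c * e)^-1 * (e * a - c * b) ^+ 2.
  by field; rewrite !gt_eqF.
apply: mulr_ge0; last by rewrite -realEsqr rpredB // rpredM // gtr0_real.
by rewrite ltW // mulr_gt0 // invr_gt0 ?mulr_gt0 ?ltr0n.
Qed.

(* For unitary [U] and [V] the left-hand side is at most the trace norm of
   [x^T y], which is the product of the lengths of [x] and [y]. *)
Lemma diag_sum_rank1_le (C : numClosedFieldType) m n (U : 'M[C]_m) (V : 'M[C]_n)
    (x : 'rV[C]_m) (y : 'rV[C]_n) (c e : C) :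
  U \is unitarymx -> V \is unitarymx -> 0 < c -> 0 < e ->
  \sum_i `|x 0 i| ^+ 2 <= c ^+ 2 -> \sum_j `|y 0 j| ^+ 2 <= e ^+ 2 ->
  `|diag_sum (U^T *m (x^T *m y) *m V)| <= c * e.
Proof.
move=> uU uV c0 e0 hx hy; rewrite /diag_sum.
set f := widen_ord _; set g := widen_ord _.
have -> : U^T *m (x^T *m y) *m V = (x *m U)^T *m (y *m V).
  by rewrite trmx_mul !mulmxA.
move: hx hy; rewrite -(unitary_norm _ _ U x uU) -(unitary_norm _ _ V y uV).
move: (x *m U) (y *m V) => u w hu hw.
have sub l (k : 'rV[C]_l) (lt : (minn m n <= l)%N) :
    \sum_(i < minn m n) `|k 0 (widen_ord lt i)| ^+ 2 <= \sum_i `|k 0 i| ^+ 2.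
  rewrite -(big_ord_narrow (F := fun i => `|k 0 i| ^+ 2) lt).
  rewrite [leRHS](bigID (fun i : 'I_l => (i < minn m n)%N)) /= lerDl.
  by apply: sumr_ge0 => i _; apply: exprn_ge0.
apply: le_trans (ler_norm_sum _ _ _) _.
have half : (0 : C) < 2^-1 by rewrite invr_gt0 ltr0n.
have t0 : 0 < e / c by rewrite divr_gt0.
have amgm k : `|((u^T *m w) (f k) (g k))| <=
    2^-1 * (e / c * `|u 0 (f k)| ^+ 2 + c / e * `|w 0 (g k)| ^+ 2).
  rewrite mxE big_ord1 mxE normrM.
  by apply: weighted_amgm; rewrite ?normr_real.
apply: le_trans (ler_sum _ (fun k _ => amgm k)) _.
rewrite -mulr_sumr big_split /= -!mulr_sumr.
have -> : c * e = 2^-1 * (e / c * c ^+ 2 + c / e * e ^+ 2).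
  by field; rewrite !gt_eqF.
apply: ler_wpM2l; first exact: ltW.
apply: lerD; apply: ler_wpM2l; try by rewrite ltW ?divr_gt0.
  exact: le_trans (sub _ u _) hu.
exact: le_trans (sub _ w _) hw.
Qed.

Lemma diag_sum_is_linear (F : pzRingType) m n : linear_for *%R (@diag_sum F m n).
Proof.
move=> a M N; rewrite /diag_sum mulr_sumr -big_split /=.
by apply: eq_bigr => k _; rewrite !mxE.
Qed.
HB.instance Definition _ (F : pzRingType) m n :=
  GRing.isLinear.Build F 'M[F]_(m, n) F *%R (@diag_sum F m n)
    (diag_sum_is_linear F m n).

(** The vector [b] is an eigenvector of [M ^t* *m M] with eigenvalue [c * e]. In the coordinates of
    the decomposition, any nonzero entry of it singles out a suitable index. *)
Lemma singular_value_of_pair (R : realType) m n (M : 'M[R[i]]_(m, n)) (s : nat -> R)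
    (a : 'cV[R[i]]_m) (b : 'cV[R[i]]_n) (c e : R) :
  singular_values M s -> b != 0 -> e != 0 ->
  M *m b = c%:C%C *: a -> M ^t* *m a = e%:C%C *: b ->
  exists k : 'I_(minn m n), s k ^+ 2 = c * e.
Proof.
move=> [_ [U [V [uU uV ->]]]] b0 e0 hb ha.
have UU : U ^t* *m U = 1%:M by apply: mulmx1C; apply/unitarymxP.
have VV : V ^t* *m V = 1%:M by apply: mulmx1C; apply/unitarymxP.
have VV' : V *m V ^t* = 1%:M by apply/unitarymxP.
pose w := V ^t* *m b; pose u := U ^t* *m a.
have Sw : rdiag_mx m n s *m w = c%:C%C *: u.
  by rewrite /u scalemxAr -hb /w !mulmxA UU mul1mx.
have Su : (rdiag_mx m n s) ^t* *m u = e%:C%C *: w.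
  rewrite /w scalemxAr -ha /u !trmx_mul !map_mxM trmxCK !mulmxA VV.
  by rewrite mul1mx.
have w0 : w != 0.
  apply: contra_neq b0 => w0; rewrite -[b]mul1mx -VV' -mulmxA -/w w0.
  by rewrite mulmx0.
have [j wj] : exists j, w j 0 != 0.
  exact/cV0Pn.
(* If [j >= m], row [j] of the adjoint of the diagonal factor vanishes, forcing [e * w j 0 = 0]. *)
have [jm|mj] := ltnP j m; last first.
  have eC : e%:C%C != 0 by rewrite fmorph_eq0.
  case/eqP: (mulf_neq0 eC wj).
  have /matrixP/(_ j 0) := Su; rewrite mxE [in RHS]mxE => <-.
  rewrite big1 // => i _; rewrite !mxE.
  by rewrite ltn_eqF ?(leq_trans _ mj) // rmorph0 mul0r.
pose i := Ordinal jm.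
have hu : (s j)%:C%C * u i 0 = e%:C%C * w j 0.
  have /matrixP/(_ j 0) := Su; rewrite mxE [in RHS]mxE => <-.
  rewrite (bigD1 i) //= big1 => [|i' ii']; rewrite !mxE ?eqxx ?addr0.
    by rewrite [X in _ = X * _]conjc_real.
  by rewrite (negPf (_ : nat_of_ord i' != j)) ?rmorph0 ?mul0r.
have hw : (s j)%:C%C * w j 0 = c%:C%C * u i 0.
  have /matrixP/(_ i 0) := Sw; rewrite mxE [in RHS]mxE => <-.
  rewrite (bigD1 j) //= big1 => [|j' jj']; rewrite !mxE ?eqxx ?addr0 //=.
  by rewrite eq_sym (negPf (_ : nat_of_ord j' != j)) ?mul0r.
have jmin : (j < minn m n)%N by rewrite leq_min jm ltn_ord.
exists (Ordinal jmin) => /=; apply: (@complexI R); apply: (mulIf wj).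
rewrite rmorphXn rmorphM /= expr2 -mulrA hw mulrCA hu.
by rewrite !mulrA.
Qed.

Lemma sum_singular_values (R : realType) m n (M : 'M[R[i]]_(m, n)) (s : nat -> R) :
  singular_values M s -> exists (U : 'M[R[i]]_m) (V : 'M[R[i]]_n),
    [/\ U \is unitarymx, V \is unitarymx &
        diag_sum (U^T *m M *m V) = (\sum_(k < minn m n) s k)%:C%C].
Proof.
(* The entrywise conjugate of the left unitary is the witness because its transpose is [U ^t*]. *)
move=> [_ [U [V [uU uV ->]]]]; exists (U ^t*)^T, V.
have UU : U ^t* *m U = 1%:M by apply: mulmx1C; apply/unitarymxP.
have VV : V ^t* *m V = 1%:M by apply: mulmx1C; apply/unitarymxP.
split=> //; first by rewrite trmx_unitary trmxC_unitary.
rewrite trmxK !mulmxA UU mul1mx -mulmxA VV mulmx1 /diag_sum rmorph_sum.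
by apply: eq_bigr => k _; rewrite mxE /= eqxx.
Qed.

(** * Separable states in filter normal form *)

(** The hypothesis is applied to the traceless part of [X], obtained by subtracting the scalar
    matrix [\tr X / n]. *)
Lemma marginal_mxtrace (R : realType) K (p : 'I_K -> R[i]) n (r : 'I_K -> 'M[R[i]]_n) :
  (0 < n)%N -> \sum_k p k = 1 -> (forall k, \tr (r k) = 1) ->
  (forall X, hermmx X -> \tr X = 0 -> \sum_k p k * \tr (r k *m X) = 0) ->
  forall X, hermmx X -> \sum_k p k * \tr (r k *m X) = \tr X / n%:R.
Proof.
move=> n0 p1 r1 fnf X hX.
have nR : (n%:R : R[i]) != 0 by rewrite pnatr_eq0 -lt0n.
have hc : \tr X / n%:R \is Num.real.
  by rewrite rpredM ?hermmx_tr_real // realV realn.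
have := fnf _ (hermmx_subl_scalar _ _ _ _ hX hc).
rewrite raddfB /= mxtrace_scalar -[(_ / _) *+ n]mulr_natr divfK // subrr => /(_ erefl) /eqP.
under eq_bigr => k _.
  rewrite mulmxBr raddfB /= mul_mx_scalar mxtraceZ r1 mulr1 mulrBr.
  over.
by rewrite sumrB -mulr_suml p1 mul1r subr_eq0 => /eqP.
Qed.

Lemma mxtrace_separable (F : comNzRingType) K (p : 'I_K -> F) m n
    (rA : 'I_K -> 'M[F]_m) (rB : 'I_K -> 'M[F]_n) X Y :
  \tr ((\sum_k p k *: (rA k *t rB k)) *m (X *t Y)) =
  \sum_k p k * (\tr (rA k *m X) * \tr (rB k *m Y)).
Proof.
rewrite mulmx_suml raddf_sum; apply: eq_bigr => k _ /=.
by rewrite -scalemxAl mxtraceZ tensmx_mul mxtrace_tens.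
Qed.

(** The traces are the coordinates of the identity, so this is Parseval for [1%:M]. *)
Lemma sum_mxtrace_onb (R : realType) n (A : 'I_(n ^ 2) -> 'M[R[i]]_n) :
  herm_onb A -> \sum_i `|\tr (A i)| ^+ 2 = n%:R.
Proof.
move=> [hA oA]; rewrite -(mxtrace1 R[i] n) -{1}(mulmx1 1%:M).
rewrite -(onb_parseval _ _ _ oA); apply: eq_bigr => i _.
by rewrite mul1mx -expr2 real_normK ?hermmx_tr_real.
Qed.

Lemma fnf_separable_singular_values (R : realType) (dA dB : nat)
    (rho : 'M[R[i]]_(dA * dB)) (A : 'I_(dA ^ 2) -> 'M[R[i]]_dA)
    (B : 'I_(dB ^ 2) -> 'M[R[i]]_dB) (sigma : nat -> R) :
  (1 < dA)%N -> (1 < dB)%N ->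
  separable rho -> filter_normal_form rho -> herm_onb A -> herm_onb B ->
  singular_values (corr_mx rho A B) sigma ->
  (exists k : 'I_(minn (dA ^ 2) (dB ^ 2)), sigma k = (Num.sqrt (dA * dB)%:R)^-1) /\
  \sum_(k < minn (dA ^ 2) (dB ^ 2)) sigma k <=
    (Num.sqrt (dA * dB)%:R)^-1
    + Num.sqrt (1 - dA%:R^-1) * Num.sqrt (1 - dB%:R^-1).
Proof.
move=> dA1 dB1 [K [p [rA [rB [p0 p1 sr rhoE]]]]] [fnfA fnfB] onA onB sv.
have [hA oA] := onA; have [hB oB] := onB.
have dA0 : (0 < dA)%N by apply: ltnW.
have dB0 : (0 < dB)%N by apply: ltnW.
have dAC : (dA%:R : R[i]) != 0 by rewrite pnatr_eq0 -lt0n.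
have dBC : (dB%:R : R[i]) != 0 by rewrite pnatr_eq0 -lt0n.
pose q k : R[i] := (p k)%:C%C.
have q1 : \sum_k q k = 1 by rewrite -rmorph_sum p1.
have trA k : \tr (rA k) = 1 by case: (sr k) => -[].
have trB k : \tr (rB k) = 1 by case: (sr k) => _ [].
have herA k : hermmx (rA k) by case: (sr k) => -[[]].
have herB k : hermmx (rB k) by case: (sr k) => _ [[]].
have margA X : hermmx X -> \sum_k q k * \tr (rA k *m X) = \tr X / dA%:R.
  apply: marginal_mxtrace => // Y hY tY.
  apply: etrans (fnfA Y hY tY); rewrite rhoE mxtrace_separable.
  by apply: eq_bigr => k _; rewrite mulmx1 trB mulr1.
have margB X : hermmx X -> \sum_k q k * \tr (rB k *m X) = \tr X / dB%:R.
  apply: marginal_mxtrace => // Y hY tY.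
  apply: etrans (fnfB Y hY tY); rewrite rhoE mxtrace_separable.
  by apply: eq_bigr => k _; rewrite mulmx1 trA mul1r.
have corrE i j : corr_mx rho A B i j =
    \sum_k q k * (\tr (rA k *m A i) * \tr (rB k *m B j)).
  by rewrite mxE rhoE mxtrace_separable.
have sumB k : \sum_j \tr (rB k *m B j) * \tr (B j) = 1.
  rewrite -(trB k) -[in RHS](mulmx1 (rB k)) -(onb_parseval _ _ _ oB).
  by apply: eq_bigr => j _; rewrite mul1mx.
have sumA k : \sum_i \tr (rA k *m A i) * \tr (A i) = 1.
  rewrite -(trA k) -[in RHS](mulmx1 (rA k)) -(onb_parseval _ _ _ oA).
  by apply: eq_bigr => i _; rewrite mul1mx.
have ab0 : (0 : R) < (dA * dB)%:R by rewrite ltr0n muln_gt0 dA0.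
split.
  have [||||k sk] := @singular_value_of_pair R _ _ _ sigma
    (\col_i \tr (A i)) (\col_j \tr (B j)) (dA%:R^-1) (dB%:R^-1) sv.
  - apply/negP => /eqP b0; move: (sum_mxtrace_onb _ _ _ onB).
    rewrite big1 => [/esym/eqP|j _]; first by rewrite (negPf dBC).
    by have /colP/(_ j) := b0; rewrite !mxE => ->; rewrite normr0 expr0n.
  - by rewrite invr_eq0 pnatr_eq0 -lt0n.
  - apply/colP => i; rewrite mxE [RHS]mxE mxE.
    (* Summing over [j] first pairs [rB k] with the identity and gives 1; the marginal on the first
       side remains. *)
    under eq_bigr => j _ do rewrite corrE mxE mulr_suml.
    rewrite exchange_big /= fmorphV rmorph_nat mulrC -margA //.
    apply: eq_bigr => k _.
    under eq_bigr => j _ do rewrite -!mulrA.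
    by rewrite -!mulr_sumr sumB mulr1.
  - apply/colP => j; rewrite mxE [RHS]mxE mxE.
    have -> : \sum_i (corr_mx rho A B ^t*) j i * (\col_i0 \tr (A i0)) i 0
      = \sum_i \sum_k q k * \tr (rB k *m B j) * (\tr (rA k *m A i) * \tr (A i)).
      apply: eq_bigr => i _.
      have -> : (corr_mx rho A B ^t*) j i = (corr_mx rho A B i j)^* by rewrite !mxE.
      rewrite corrE mxE rmorph_sum mulr_suml.
      apply: eq_bigr => k _; rewrite !rmorphM /=.
      (* The conjugation in the adjoint disappears, since the traces and the weights are real. *)
      rewrite (CrealP (hermmx_trM_real _ _ _ _ (herA k) (hA i))).
      rewrite (CrealP (hermmx_trM_real _ _ _ _ (herB k) (hB j))).
      by rewrite [X in X * _ * _]conjc_real -/(q k); ring.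
    rewrite exchange_big /= fmorphV rmorph_nat mulrC -margB //.
    by apply: eq_bigr => k _; rewrite -mulr_sumr sumA mulr1.
  exists k; apply/eqP; rewrite -(eqrXn2 (n := 2)) //.
  - by rewrite sk exprVn sqr_sqrtr ?ltW // natrM invfM.
  - exact: sv.1.
  - by rewrite invr_ge0 sqrtr_ge0.
have [U [V [uU uV tE]]] := sum_singular_values _ _ _ _ _ sv.
pose a := \row_i \tr (A i); pose b := \row_j \tr (B j).
pose xi k := \row_i (\tr (rA k *m A i) - \tr (A i) / dA%:R).
pose eta k := \row_j (\tr (rB k *m B j) - \tr (B j) / dB%:R).
(* When the centred products are averaged, each cross term contributes [- tA * tB / (dA * dB)] and
   the constant term [+ tA * tB / (dA * dB)], so exactly one such term must be added back. *)
have decomp : corr_mx rho A B =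
    (dA%:R * dB%:R)^-1 *: (a^T *m b) + \sum_k q k *: ((xi k)^T *m eta k).
  apply/matrixP => i j; rewrite corrE mxE summxE mxE mxE big_ord1 !mxE.
  set tA := \tr (A i); set tB := \tr (B j).
  have -> : \sum_k (q k *: ((xi k)^T *m eta k)) i j =
     \sum_k (q k * (\tr (rA k *m A i) * \tr (rB k *m B j))
       - (q k * \tr (rA k *m A i)) * (tB / dB%:R)
       - (q k * \tr (rB k *m B j)) * (tA / dA%:R)
       + q k * (tA / dA%:R * (tB / dB%:R))).
    by apply: eq_bigr => k _; rewrite mxE mxE big_ord1 !mxE -/tA -/tB; ring.
  rewrite big_split /= sumrB sumrB -!mulr_suml q1 margA // margB //.
  by rewrite -/tA -/tB; field; rewrite dAC dBC.
have natC m : (m%:R : R[i]) = (m%:R : R)%:C%C by rewrite rmorph_nat.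
have inv_lt1 m : (1 < m)%N -> (0 : R) < 1 - m%:R^-1.
  by move=> m1; rewrite subr_gt0 invf_lt1 ?ltr1n ?ltr0n // ltnW.
have sqrtC (x : R) : 0 <= x -> (Num.sqrt x)%:C%C ^+ 2 = x%:C%C :> R[i].
  by move=> x0; rewrite -rmorphXn sqr_sqrtr.
have gtC (x : R) : 0 < x -> 0 < (Num.sqrt x)%:C%C :> R[i].
  by move=> x0; rewrite ltcR sqrtr_gt0.
(* With the prefactor [1 / (dA * dB)] this bound becomes [1 / sqrt (dA * dB)], that is, [alpha]. *)
have bound_ab : `|diag_sum (U^T *m (a^T *m b) *m V)| <=
    (Num.sqrt dA%:R)%:C%C * (Num.sqrt dB%:R)%:C%C.
  apply: diag_sum_rank1_le => //; rewrite ?gtC ?ltr0n // sqrtC ?ler0n // -natC.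
    by under eq_bigr => i _ do rewrite mxE; rewrite sum_mxtrace_onb.
  by under eq_bigr => i _ do rewrite mxE; rewrite sum_mxtrace_onb.
(* The rank-one bound asks for positive radii; this is where both dimensions must exceed 1. *)
have bound_xi k : `|diag_sum (U^T *m ((xi k)^T *m eta k) *m V)| <=
    (Num.sqrt (1 - dA%:R^-1))%:C%C * (Num.sqrt (1 - dB%:R^-1))%:C%C.
  apply: diag_sum_rank1_le => //; rewrite ?gtC ?inv_lt1 //.
    rewrite (sqrtC _ (ltW (inv_lt1 _ dA1))) rmorphB rmorph1 fmorphV rmorph_nat /=.
    under eq_bigr => i _ do rewrite mxE.
    by apply: state_centered_norm => //; case: (sr k).
  rewrite (sqrtC _ (ltW (inv_lt1 _ dB1))) rmorphB rmorph1 fmorphV rmorph_nat /=.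
  under eq_bigr => i _ do rewrite mxE.
  by apply: state_centered_norm => //; case: (sr k).
have s0 : 0 <= (\sum_(k < minn (dA ^ 2) (dB ^ 2)) sigma k)%:C%C.
  by rewrite ler0c sumr_ge0 // => k _; apply: sv.1.
rewrite -lecR -(ger0_norm s0) -tE decomp mulmxDr mulmxDl -scalemxAr -scalemxAl.
rewrite raddfD /= linearZ /= mulmx_sumr mulmx_suml raddf_sum /= rmorphD /=.
apply: le_trans (ler_normD _ _) _; apply: lerD.
  have dd0 : 0 <= (dA%:R * dB%:R)^-1 :> R[i] by rewrite -natrM invr_ge0 ler0n.
  rewrite normrM ger0_norm //; apply: le_trans (ler_wpM2l dd0 bound_ab) _.
  rewrite -[X in _ * X](rmorphM (real_complex R)) -sqrtrM ?ler0n // -!natrM natC.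
  rewrite -[X in X * _](fmorphV (real_complex R)) -(rmorphM (real_complex R)) lecR.
  rewrite -{1}(sqr_sqrtr (ltW ab0)) expr2 invfM -mulrA mulVf ?mulr1 //.
  by rewrite sqrtr_eq0 -ltNge.
apply: le_trans (ler_norm_sum _ _ _) _.
(* The bound is the same for every [k], and the weights [q k] sum to 1. *)
rewrite rmorphM /= -[leRHS]mul1r -q1 mulr_suml; apply: ler_sum => k _.
have qk : 0 <= q k by rewrite ler0c.
by rewrite -scalemxAr -scalemxAl linearZ /= normrM ger0_norm // ler_wpM2l.
Qed.

(** * Combining the trace-norm bound with Maclaurin's inequality *)

Theorem theorem1 (R : realType) (dA dB h : nat) :
  (0 < dA)%N -> (0 < dB)%N ->
  let d := minn dA dB in
  let D := maxn dA dB in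
  (D <= d ^ 3)%N -> (1 < h)%N -> (h <= d ^ 2)%N ->
  let alpha : R := 1 / Num.sqrt ((D * d)%:R) in
  let beta : R := Num.sqrt (((D%:R - 1) / (D%:R * (d%:R ^+ 2 - 1)))
                           * ((d%:R - 1) / (d%:R * (d%:R ^+ 2 - 1)))) in
  forall (rho : 'M[R[i]]_(dA * dB))
         (A : 'I_(dA ^ 2) -> 'M[R[i]]_dA) (B : 'I_(dB ^ 2) -> 'M[R[i]]_dB)
         (sigma : nat -> R),
    is_state rho -> separable rho -> filter_normal_form rho ->
    herm_onb A -> herm_onb B ->
    singular_values (corr_mx rho A B) sigma ->
    CMN1 (dA ^ 2) (dB ^ 2) h sigma
      <= esym_poly h (fun k : 'I_(d ^ 2) => if (k : nat) == 0%N then alpha else beta).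
Proof.
move=> dA0 dB0 d D _ h1 hd alpha beta rho A B sigma _ sep fnf onA onB sv.
(* The range of [h] excludes [d = 1], where the denominators in [beta] vanish. *)
have n1 : (1 < d ^ 2)%N := leq_trans h1 hd.
have d1 : (1 < d)%N by move: n1; rewrite (ltn_sqr 1).
have [dA1 dB1] : (1 < dA)%N /\ (1 < dB)%N by apply/andP; rewrite -leq_min.
have [[j sj] sum_le] :=
  fnf_separable_singular_values R dA dB rho A B sigma dA1 dB1 sep fnf onA onB sv.
have [Dd_mul Dd_dec] : (D * d = dA * dB)%N /\
    (1 - dA%:R^-1) * (1 - dB%:R^-1) = (1 - D%:R^-1) * (1 - d%:R^-1) :> R.
  by rewrite /D /d; case: (leqP dA dB) => _; split; rewrite // (mulnC, mulrC).
have alphaE : alpha = (Num.sqrt (dA * dB)%:R)^-1 by rewrite /alpha Dd_mul div1r.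
have D1 : (1 < D)%N by rewrite leq_max dA1.
have nE : minn (dA ^ 2) (dB ^ 2) = (d ^ 2)%N.
  by rewrite /d; case: (leqP dA dB) => dAB; [apply/minn_idPl | apply/minn_idPr];
     rewrite leq_sqr // ltnW.
have dR : (1 : R) < d%:R by rewrite ltr1n.
have DR : (1 : R) < D%:R by rewrite ltr1n.
have N0 : (0 : R) < d%:R ^+ 2 - 1 by rewrite subr_gt0 expr_gt1.
have betaE : (d ^ 2).-1%:R * beta = Num.sqrt (1 - dA%:R^-1) * Num.sqrt (1 - dB%:R^-1).
  rewrite -sqrtrM; last by rewrite subr_ge0 invf_le1 ?ler1n ?ltr0n.
  rewrite Dd_dec -subn1 natrB 1?ltnW // natrX.
  (* Writing [d ^ 2 - 1] as the root of its square moves it under the root of [beta], where it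
     cancels both denominators. *)
  rewrite -[X in X * _]ger0_norm 1?ltW // -sqrtr_sqr -sqrtrM ?sqr_ge0 //.
  congr Num.sqrt; field.
  by rewrite !gt_eqF // (lt_trans ltr01).
have z0 : (0 < d ^ 2)%N by apply: ltnW.
(* The singular values are not assumed sorted: [alpha] sits at some index [j] on the left and at
   index 0 on the right. *)
apply: (@esym_poly_le_equalized R _ _ h _ j _ (Ordinal z0) alpha beta) => //.
- by rewrite nE -subn1 subn_gt0.
- by move=> k; apply: sv.1.
- exact: sqrtr_ge0.
- by rewrite sj alphaE.
- by rewrite [X in X.-1%:R]nE betaE alphaE.
- by move=> i i0; rewrite (negPf (_ : nat_of_ord i != 0%N)).
Qed.
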